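(* Let $K$ be a field and let $P \subset \mathbb{R}^d$ be a $(0,1)$-polytope. If the toric ideal $I_P$ is quadratic, then every clique of the $1$-skeleton $\mathrm{sk}(P)$ is the vertex set of a face of $P$.
   Context: A $(0,1)$-polytope in $\mathbb{R}^d$ is a convex polytope all of whose vertices lie in $\{0,1\}^d$; then $P\cap\mathbb{Z}^d$ is exactly the vertex set of $P$. The $1$-skeleton $\mathrm{sk}(P)$ is the finite simple graph whose vertices are the vertices of $P$, with two distinct vertices $v,w$ adjacent iff $\mathrm{conv}(\{v,w\})$ is an edge ($1$-dimensional face) of $P$. A clique of a graph is the vertex set of a complete subgraph. $P$ itself is regarded as a face of $P$. Let $P \cap \mathbb{Z}^d = \{\mathbf{a}_1,\dots,\mathbf{a}_n\}$ (distinct points). The toric ideal $I_P$ is the kernel of the $K$-algebra homomorphism $\pi : K[x_1,\dots,x_n] \to K[t_1^{\pm1},\dots,t_d^{\pm 1},s]$, $\pi(x_i)=\mathbf{t}^{\mathbf{a}_i}s$, where $\mathbf{t}^{\mathbf{a}}=t_1^{a_1}\cdots t_d^{a_d}$ for $\mathbf{a}=(a_1,\dots,a_d)$. A binomial is a difference of two distinct monomials (each with coefficient $1$). $I_P$ is called quadratic if it is generated by quadratic (homogeneous of degree $2$) binomials; the zero ideal counts as quadratic (empty generating set). *)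

(* Defs.v *)
From HB Require Import structures.
From mathcomp Require Import all_boot all_order all_algebra.
From mathcomp Require Import classical_sets reals.
From mathcomp Require Import mpoly.

Set Implicit Arguments.
Unset Strict Implicit.
Unset Printing Implicit Defensive.

Import Order.TTheory GRing.Theory Num.Theory.
Local Open Scope classical_set_scope.
Local Open Scope ring_scope.

Definition conv (R : realType) (d : nat) (A : set 'rV[R]_d) : set 'rV[R]_d :=
  [set x | exists (m : nat) (l : 'I_m -> R) (y : 'I_m -> 'rV[R]_d),
      [/\ forall i, 0 <= l i,
          \sum_(i < m) l i = 1,
          forall i, A (y i)
        & x = \sum_(i < m) l i *: y i]].

Definition polytope (R : realType) (d : nat) (P : set 'rV[R]_d) : Prop :=
  exists s : seq 'rV[R]_d, P = conv [set` s].

Definition dot (R : realType) (d : nat) (c x : 'rV[R]_d) : R :=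
  \sum_(j < d) c 0 j * x 0 j.

(* [F] is cut out of [P] by an inequality valid on [P]. With [c = 0] one gets
   the two improper faces, [P] itself ([b = 0]) and the empty set ([b = 1]). *)
Definition face (R : realType) (d : nat) (P F : set 'rV[R]_d) : Prop :=
  exists (c : 'rV[R]_d) (b : R),
    (forall x, P x -> dot c x <= b) /\ F = P `&` [set x | dot c x = b].

Definition vertices (R : realType) (d : nat) (P : set 'rV[R]_d) :
    set 'rV[R]_d :=
  [set v | face P [set v]].

Definition zero_one_polytope (R : realType) (d : nat) (P : set 'rV[R]_d) :
    Prop :=
  polytope P /\
  forall v, vertices P v -> forall j : 'I_d, v 0 j = 0 \/ v 0 j = 1.

(* Adjacency in the 1-skeleton, whose vertex set is [vertices P]. For [v <> w]
   the segment is 1-dimensional, so being a face makes it an edge. *)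
Definition sk_adj (R : realType) (d : nat) (P : set 'rV[R]_d)
    (v w : 'rV[R]_d) : Prop :=
  [/\ vertices P v, vertices P w, v <> w & face P (conv [set v; w])].

Definition sk_clique (R : realType) (d : nat) (P C : set 'rV[R]_d) : Prop :=
  C `<=` vertices P /\
  forall v w, C v -> C w -> v <> w -> sk_adj P v w.

(* [a] lists the points of [P `&` Z^d] without repetition. *)
Definition lattice_points (R : realType) (d : nat) (P : set 'rV[R]_d) (n : nat)
    (a : 'I_n -> 'rV[int]_d) : Prop :=
  injective a /\
  forall z : 'rV[int]_d, P (map_mx (fun k : int => k%:~R) z) <->
                         exists i, a i = z.

Definition tvar (K : fieldType) (d : nat) (j : 'I_d) :
    {fraction {mpoly K[d + 1]}} :=
  tofrac 'X_(lshift 1 j).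

Definition svar (K : fieldType) (d : nat) : {fraction {mpoly K[d + 1]}} :=
  tofrac 'X_(rshift d ord0).

(* The codomain is the field K(t_1, ..., t_d, s); the values lie in its subring
   K[t_1^{+-1}, ..., t_d^{+-1}, s], so the kernel is that of the monomial map
   into Laurent polynomials. *)
Definition toric_map (K : fieldType) (d n : nat) (a : 'I_n -> 'rV[int]_d)
    (p : {mpoly K[n]}) : {fraction {mpoly K[d + 1]}} :=
  mmap (@tofrac _ \o @mpolyC (d + 1) K)
       (fun i : 'I_n => (\prod_(j < d) tvar K j ^ a i 0 j) * svar K d) p.

Definition toric_ideal (K : fieldType) (d n : nat) (a : 'I_n -> 'rV[int]_d) :
    set {mpoly K[n]} :=
  [set p | toric_map a p = 0].

Arguments toric_ideal K {d n} a.

Definition ideal_span (K : fieldType) (n : nat) (G : set {mpoly K[n]}) :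
    set {mpoly K[n]} :=
  [set p | exists (m : nat) (q g : 'I_m -> {mpoly K[n]}),
      (forall i, G (g i)) /\ p = \sum_(i < m) q i * g i].

Definition quadratic_binomial (K : fieldType) (n : nat) (p : {mpoly K[n]}) :
    Prop :=
  (exists m1 m2 : 'X_{1..n}, m1 != m2 /\ p = 'X_[m1] - 'X_[m2]) /\
  p \is 2.-homog.

Definition quadratic_ideal (K : fieldType) (n : nat) (I : set {mpoly K[n]}) :
    Prop :=
  exists G : set {mpoly K[n]},
    (forall g, G g -> quadratic_binomial g) /\ I = ideal_span G.

(* Main.v *)
Require Import Defs.
From mathcomp Require Import all_boot all_order all_algebra.
From mathcomp Require Import boolp classical_sets reals.
From mathcomp Require Import mpoly.
From mathcomp Require Import lra.

Set Implicit Arguments.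
Unset Strict Implicit.
Unset Printing Implicit Defensive.

Import Order.TTheory GRing.Theory Num.Theory.
Local Open Scope classical_set_scope.
Local Open Scope ring_scope.

(** Let [C] be a clique and suppose first that the lattice points of [P] in [C]
    are not separated from some other lattice point [w], that is, no affine
    function is [<= 0] on all lattice points, [= 0] on [C] and [< 0] at [w]. By
    Farkas' lemma over the rationals (the data are integral) and after clearing
    denominators, some positive multiple of [w] plus a sum of lattice points
    equals a sum of elements of [C], with the same number of terms on both sides
    ([separation_or_relation]). So there are monomials [u] and [v], with [w] in
    the support of [u] and the support of [v] contained in [C], such that
    [u - v] lies in the toric ideal.

    A quadratic binomial of the ideal is a relation [p + q = x + y] between
    lattice points. When [p] and [q] are in [C], the segment [pq] is a face of
    [P], so it contains [x] and [y]; its only lattice points are [p] and [q],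
    because these are distinct 0/1 vectors (or equal), hence [{x, y} = {p, q}]
    ([edge_sum]). Therefore neither monomial of a quadratic generator divides
    [v], and the coefficient of [v] vanishes in every element of the ideal
    ([ideal_span_isolated]). This contradicts the membership of [u - v]
    ([quadratic_fiber_rigid]).

    So every lattice point outside [C] is separated from [C]; the sum of the
    separating functions vanishes exactly on [C] and is negative at all other
    lattice points ([strict_separation]). Its zero set on [P] is a face, and
    since [P] is the convex hull of its vertices ([polytope_vertex_hull]), which
    are lattice points, this face is the convex hull of [C]; its vertices are
    the points of [C]. *)

(** * Farkas' lemma over an ordered field *)

Section Farkas.
Variable F : realFieldType.

(** The scalar product over any ordered field; over the reals it is convertible
    to [dot], and it is also needed over the rationals. *)
Definition sprod d (c x : 'rV[F]_d) : F := \sum_(j < d) c 0 j * x 0 j.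

Lemma sprodDl d (c c' x : 'rV[F]_d) : sprod (c + c') x = sprod c x + sprod c' x.
Proof. by rewrite -big_split; apply: eq_bigr => j _; rewrite mxE mulrDl. Qed.

Lemma sprodZl d k (c x : 'rV[F]_d) : sprod (k *: c) x = k * sprod c x.
Proof. by rewrite mulr_sumr; apply: eq_bigr => j _; rewrite mxE mulrA. Qed.

Lemma sprodDr d (c x x' : 'rV[F]_d) : sprod c (x + x') = sprod c x + sprod c x'.
Proof. by rewrite -big_split; apply: eq_bigr => j _; rewrite mxE mulrDr. Qed.

Lemma sprodZr d k (c x : 'rV[F]_d) : sprod c (k *: x) = k * sprod c x.
Proof. by rewrite mulr_sumr; apply: eq_bigr => j _; rewrite mxE mulrCA. Qed.

Lemma sprod0r d (c : 'rV[F]_d) : sprod c 0 = 0.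
Proof. by rewrite -(scale0r 0) sprodZr mul0r. Qed.

Lemma sprodNl d (c x : 'rV[F]_d) : sprod (- c) x = - sprod c x.
Proof. by rewrite -scaleN1r sprodZl mulN1r. Qed.

Lemma sprodNr d (c x : 'rV[F]_d) : sprod c (- x) = - sprod c x.
Proof. by rewrite -scaleN1r sprodZr mulN1r. Qed.

Lemma sprod_sumr d (I : finType) (c : 'rV[F]_d) (l : I -> F) (x : I -> 'rV[F]_d) :
  sprod c (\sum_i l i *: x i) = \sum_i l i * sprod c (x i).
Proof.
rewrite (big_morph _ (sprodDr c) (sprod0r c)).
by apply: eq_bigr => i _; rewrite sprodZr.
Qed.

Lemma sprod_suml d (I : finType) (Q : pred I) (c : I -> 'rV[F]_d) (x : 'rV[F]_d) :
  sprod (\sum_(i | Q i) c i) x = \sum_(i | Q i) sprod (c i) x.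
Proof.
apply: (big_morph (fun c => sprod c x)) => [c1 c2|]; first exact: sprodDl.
by rewrite -(scale0r 0) sprodZl mul0r.
Qed.

(** Induction on the number of generators. If the separator [y0] that works for
    the generators other than [u0] is negative on [u0], everything is projected
    along [u0] onto the kernel of [y0]; in either case of the induction
    hypothesis the answer for the projected data is lifted back. *)
Lemma farkas d m (u : 'I_m -> 'rV[F]_d) (w : 'rV[F]_d) :
  (exists l : 'I_m -> F, (forall i, 0 <= l i) /\ w = \sum_i l i *: u i) \/
  (exists y, (forall i, 0 <= sprod y (u i)) /\ sprod y w < 0).
Proof.
elim: m u w => [|m IH] u w.
  have [->|w0] := eqVneq w 0.
    by left; exists (fun=> 0); rewrite big_ord0; split=> [[]|].
  right; exists (- w); split=> [[]//|]; rewrite sprodNl oppr_lt0.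
  have [j wj] : exists j, w 0 j != 0.
    apply/existsP; apply: contra_neqT w0 => /existsPn w0.
    by apply/rowP => j; rewrite mxE; apply/eqP/negbNE/w0.
  rewrite /sprod (bigD1 j) //= ltr_pwDl //; first by rewrite -expr2 exprn_even_gt0.
  by apply: sumr_ge0 => k _; rewrite -expr2 sqr_ge0.
pose v i := u (lift ord0 i).
pose ext t (l : 'I_m -> F) i := oapp l t (unlift ord0 i).
have extE t (l : 'I_m -> F) : \sum_i ext t l i *: u i = t *: u ord0 + \sum_i l i *: v i.
  rewrite big_ord_recl /ext unlift_none; congr (_ + _).
  by apply: eq_bigr => i _; rewrite liftK.
have ext_ge0 t l : 0 <= t -> (forall i, 0 <= l i) -> forall i, 0 <= ext t l i.
  by move=> t0 l0 i; rewrite /ext; case: (unlift ord0 i) => /=.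
case: (IH v w) => [[l [l0 ->]]|[y0 [y0v y0w]]].
  by left; exists (ext 0 l); split; [exact: ext_ge0|rewrite extE scale0r add0r].
have [y0u|y0u] := leP 0 (sprod y0 (u ord0)).
  by right; exists y0; split=> // i; case: (unliftP ord0 i) => [j|] ->; [exact: y0v|].
(* Normalised so that y takes the value -1 on u0, and pr is the projection. *)
pose y := (- sprod y0 (u ord0))^-1 *: y0.
have k0 : 0 < (- sprod y0 (u ord0))^-1 by rewrite invr_gt0 oppr_gt0.
have yu : sprod y (u ord0) = -1.
  by rewrite sprodZl invrN mulNr mulVf // lt_eqF.
have yv i : 0 <= sprod y (v i) by rewrite sprodZl mulr_ge0 // ltW.
have yw : sprod y w < 0 by rewrite sprodZl pmulr_rlt0.
pose pr x := x + sprod y x *: u ord0.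
case: (IH (pr \o v) (pr w)) => [[l [l0 /= E]]|[z [zv zw]]].
  left; exists (ext (\sum_i l i * sprod y (v i) - sprod y w) l); split.
    apply: ext_ge0 => //; rewrite subr_ge0 (le_trans (ltW yw)) //.
    by apply: sumr_ge0 => i _; rewrite mulr_ge0.
  rewrite extE -[LHS](addrK (sprod y w *: u ord0)) -/(pr w) E.
  rewrite scalerBl addrAC; congr (_ - _).
  rewrite scaler_suml -big_split; apply: eq_bigr => i _ /=.
  by rewrite scalerDr scalerA addrC.
have zE x : sprod (z + sprod z (u ord0) *: y) x = sprod z (pr x).
  by rewrite sprodDl sprodZl sprodDr sprodZr [X in _ + X]mulrC.
right; exists (z + sprod z (u ord0) *: y); split; last by rewrite zE.
move=> i; case: (unliftP ord0 i) => [j|] ->; first by rewrite zE; apply: zv.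
by rewrite sprodDl sprodZl yu mulrN1 subrr.
Qed.

(** The embedding of affine space at height 1, which turns affine functions and
    affine relations into linear ones. *)
Definition cone_point d (x : 'rV[F]_d) : 'rV[F]_(d + 1) := row_mx x (const_mx 1).

Lemma sprod_cone_point d (y : 'rV[F]_(d + 1)) (x : 'rV[F]_d) :
  sprod y (cone_point x) = sprod (lsubmx y) x + y 0 (rshift d ord0).
Proof.
rewrite /sprod big_split_ord big_ord1 /= row_mxEr mxE mulr1; congr (_ + _).
by apply: eq_bigr => j _; rewrite row_mxEl mxE.
Qed.

Lemma cone_point_sum d (I : finType) (l : I -> F) (x : I -> 'rV[F]_d) (z : 'rV[F]_(d + 1)) :
  z = \sum_i l i *: cone_point (x i) ->
  lsubmx z = \sum_i l i *: x i /\ z 0 (rshift d ord0) = \sum_i l i.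
Proof.
move=> ->; split.
  by rewrite linear_sum; apply: eq_bigr => i _; rewrite linearZ /= row_mxKl.
by rewrite summxE; apply: eq_bigr => i _; rewrite mxE row_mxEr mxE mulr1.
Qed.

End Farkas.

Lemma split_lshift m n (j : 'I_m) : split (lshift n j) = inl j.
Proof. exact: (unsplitK (inl j)). Qed.

Lemma split_rshift m n (j : 'I_n) : split (rshift m j) = inr j.
Proof. exact: (unsplitK (inr j)). Qed.

(** * Polytopes and supporting hyperplanes *)

Section Convex.
Variables (R : realType) (d : nat).
Implicit Types (c x v : 'rV[R]_d) (s : seq 'rV[R]_d) (P A : set 'rV[R]_d).

Lemma dot_wsum m c (l : 'I_m -> R) (y : 'I_m -> 'rV[R]_d) :
  dot c (\sum_i l i *: y i) = \sum_i l i * dot c (y i).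
Proof. exact: (@sprod_sumr R). Qed.

Lemma dot_wsum_le m c b (l : 'I_m -> R) (y : 'I_m -> 'rV[R]_d) :
  (forall i, 0 <= l i) -> \sum_i l i = 1 -> (forall i, dot c (y i) <= b) ->
  dot c (\sum_i l i *: y i) <= b /\
  (dot c (\sum_i l i *: y i) = b -> forall i, l i != 0 -> dot c (y i) = b).
Proof.
move=> l0 l1 yb; have lb i : l i * dot c (y i) <= l i * b by rewrite ler_wpM2l.
have sb : \sum_i l i * b = b by rewrite -mulr_suml l1 mul1r.
rewrite dot_wsum; split; first by rewrite -[leRHS]sb; apply: ler_sum.
move=> E i li; apply: (mulfI li); apply/eqP; rewrite -subr_eq0 -oppr_eq0 opprB.
have: \sum_i (l i * b - l i * dot c (y i)) == 0 by rewrite sumrB sb E subrr.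
by rewrite psumr_eq0 => [/allP/(_ i (mem_index_enum _))//|j _]; rewrite subr_ge0.
Qed.

Lemma conv_sub A : A `<=` conv A.
Proof.
move=> x Ax; exists 1, (fun=> 1), (fun=> x).
by rewrite !big_ord1 scale1r; split.
Qed.

Lemma conv_le A c b x : (forall y, A y -> dot c y <= b) -> conv A x -> dot c x <= b.
Proof.
move=> Ab [m [l [y [l0 l1 yA ->]]]].
by have [] := dot_wsum_le l0 l1 (fun i => Ab _ (yA i)).
Qed.

(** A convex combination that attains the maximum of a functional only involves
    points where that maximum is attained. *)
Lemma conv_face A c b x : (forall y, A y -> dot c y <= b) -> conv A x ->
  dot c x = b -> conv (A `&` [set y | dot c y = b]) x.
Proof.
move=> Ab [m [l [y [l0 l1 yA ->]]]] xb.
have [_ /(_ xb) lb] := dot_wsum_le l0 l1 (fun i => Ab _ (yA i)).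
have [i0 li0] : exists i, l i != 0.
  apply/existsP; apply: contra_eqT l1 => /existsPn l1.
  by rewrite big1 1?eq_sym ?oner_eq0 // => i _; apply/eqP/negbNE/l1.
(* Points of weight zero are replaced by a point of nonzero weight. *)
exists m, l, (fun i => if l i == 0 then y i0 else y i); split => //.
  by move=> i; case: eqP => [_|/eqP li]; split => //; apply: lb.
by apply: eq_bigr => i _; case: eqP => // ->; rewrite !scale0r.
Qed.

Lemma conv1 v x : conv [set v] x -> x = v.
Proof.
move=> [m [l [y [_ l1 yv ->]]]]; rewrite (eq_bigr (fun i => l i *: v)).
  by rewrite -scaler_suml l1 scale1r.
by move=> i _; rewrite (yv i).
Qed.

Lemma conv_mono A B : A `<=` B -> conv A `<=` conv B.
Proof.
move=> AB x [m [l [y [l0 l1 yA ->]]]]; exists m, l, y.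
by split => // i; apply: AB.
Qed.

Lemma conv0 x : ~ conv set0 x.
Proof.
move=> [[|m] [l [y [_ l1 y0 _]]]]; last exact: (y0 ord0).
by move: l1; rewrite big_ord0 => /esym/eqP; rewrite oner_eq0.
Qed.

(** The functional exposing [v] in [P] is maximal at every point of [A] that occurs with
    nonzero weight in the combination giving [v], so these points equal [v]. *)
Lemma vertex_in_generators P A v : vertices P v -> A `<=` P -> conv A v -> A v.
Proof.
move=> [c [b [Pb Pv]]] AP Av.
have [_ vb] : (P `&` [set x | dot c x = b]) v by rewrite -Pv.
have cv := conv_face (fun y Ay => Pb y (AP y Ay)) Av vb.
have sub : A `&` [set y | dot c y = b] `<=` [set v].
  by rewrite Pv => y [Ay yb]; split => //; apply: AP.
have [y [Ay yb]] : (A `&` [set y | dot c y = b]) !=set0.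
  by apply/set0P/eqP => E; rewrite E in cv; apply: (conv0 cv).
by rewrite -(sub y).
Qed.

(** Farkas' lemma for the cone over [s]: the height coordinate of a cone
    combination says that its coefficients add up to 1. *)
Lemma conv_separation s x : ~ conv [set` s] x ->
  exists c b, (forall y, y \in s -> dot c y <= b) /\ b < dot c x.
Proof.
move=> sx.
case: (farkas (fun i : 'I_(size s) => cone_point s`_i) (cone_point x)).
  move=> [l [l0 E]].
  have [] := cone_point_sum E; rewrite row_mxKl row_mxEr mxE => Ex E1.
  case: sx; exists (size s), l, (fun i => s`_i); split=> // i.
  by apply: mem_nth.
move=> [y [ys yx]]; exists (- lsubmx y), (y 0 (rshift d ord0)); split=> [z zs|].
  have := ys (Ordinal (etrans (index_mem z s) zs)).
  by rewrite /= nth_index // sprod_cone_point -[dot _ _]/(sprod _ _) sprodNl; lra.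
by move: yx; rewrite sprod_cone_point -[dot _ _]/(sprod _ _) sprodNl; lra.
Qed.

(** Generators that lie in the hull of the other ones are discarded. When none is
    left, a hyperplane separating a generator from all the others, moved to pass
    through that generator, exposes it as a vertex. *)
Lemma polytope_vertex_hull P : polytope P ->
  exists s, P = conv [set` s] /\ forall v, v \in s -> vertices P v.
Proof.
move=> [s]; have [k] := ubnP (size s); elim: k s => // k IH s sk Ps.
have [[v [vs vr]]|irr] := pselect (exists v, v \in s /\ conv [set` rem v s] v).
  apply: (IH (rem v s)).
    rewrite size_rem // -ltnS (leq_trans _ sk) // ltnS prednK // -has_predT.
    by apply/hasP; exists v.
  rewrite Ps; apply/seteqP; split=> x; last by apply: conv_mono => y; apply: mem_rem.
  move=> xs; apply: contrapT => /conv_separation [c [b [rb]]]; apply/negP; rewrite -leNgt.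
  apply: conv_le xs => y /= ys; have [->|yv] := eqVneq y v; first exact: conv_le vr.
  by apply: rb; move: ys; rewrite (perm_mem (perm_to_rem vs)) inE (negPf yv).
exists s; split=> // v vs.
have /conv_separation [c [b [rb vb]]] : ~ conv [set` rem v s] v.
  by move=> vr; apply: irr; exists v.
have sb y : y \in s -> dot c y <= dot c v /\ (dot c y = dot c v -> y = v).
  rewrite (perm_mem (perm_to_rem vs)) inE => /orP[/eqP ->//|/rb yb].
  have yv := le_lt_trans yb vb; split; first exact: ltW.
  by move=> E; move: yv; rewrite E ltxx.
have sb1 y : y \in s -> dot c y <= dot c v by case/sb.
exists c, (dot c v); rewrite Ps; split=> [x|]; first exact: conv_le.
apply/seteqP; split=> [_ ->|x [xs xv]].
  by split=> //; apply: conv_sub.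
apply: conv1; apply: conv_mono (conv_face sb1 xs xv) => y [/sb[_ h]]; exact: h.
Qed.

End Convex.

(** * Lattice points on the edges of a 0/1-polytope *)

Section ZeroOne.
Variables (R : realType) (d : nat).
Implicit Types (p q v x y : 'rV[R]_d) (P : set 'rV[R]_d).

Lemma conv2 p q x : conv [set p; q] x ->
  exists t, [/\ 0 <= t, t <= 1 & x = t *: p + (1 - t) *: q].
Proof.
move=> [m [l [y [l0 l1 ypq ->]]]].
have tE : 1 - \sum_(i | y i == p) l i = \sum_(i | y i != p) l i.
  by rewrite -l1 (bigID (fun i => y i == p)) /= addrAC subrr add0r.
exists (\sum_(i | y i == p) l i); split; first exact: sumr_ge0.
  by rewrite -subr_ge0 tE sumr_ge0.
rewrite tE (bigID (fun i => y i == p)) /= !scaler_suml; congr (_ + _).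
  by apply: eq_bigr => i /eqP ->.
by apply: eq_bigr => i yi; case: (ypq i) => [E|->//]; rewrite E eqxx in yi.
Qed.

(** The functional that defines the edge is at most [b] at [x] and [y], and its
    values there add up to [2 b], so both lie on the edge; in a coordinate where
    [p] and [q] differ, the integrality of [x] makes it an endpoint. The case
    [p = q] of a vertex is included. *)
Lemma edge_sum P p q x y (z : 'rV[int]_d) :
  (forall j, p 0 j = 0 \/ p 0 j = 1) -> (forall j, q 0 j = 0 \/ q 0 j = 1) ->
  face P (conv [set p; q]) -> P x -> P y -> x + y = p + q ->
  x = map_mx (fun k : int => k%:~R) z -> x = p \/ x = q.
Proof.
move=> p01 q01 [c [b [Pb E]]] Px Py xy xz.
have [[_ pb] [_ qb]] : (P `&` [set x | dot c x = b]) p /\ (P `&` [set x | dot c x = b]) q.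
  by rewrite -E; split; apply: conv_sub; [left|right].
have xb : dot c x = b.
  have := congr1 (dot c) xy; rewrite [LHS](@sprodDr R) [RHS](@sprodDr R).
  move: (Pb _ Px) (Pb _ Py) pb qb; rewrite /= /dot /sprod; lra.
have [t [t0 t1 xt]] : exists t, [/\ 0 <= t, t <= 1 & x = t *: p + (1 - t) *: q].
  by apply: conv2; rewrite E.
have [pq|pq] := eqVneq p q; first by left; rewrite xt pq -scalerDl addrC subrK scale1r.
have [j pqj] : exists j, p 0 j != q 0 j.
  apply/existsP; apply: contra_neqT pq => /existsPn pq.
  by apply/rowP => j; apply/eqP/negbNE/pq.
suff [t00|t11] : t = 0 \/ t = 1.
- by right; rewrite xt t00 scale0r add0r subr0 scale1r.
- by left; rewrite xt t11 scale1r subrr scale0r addr0.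
have : x 0 j = (z 0 j)%:~R by rewrite xz mxE.
have int01 (k : int) (r : R) : 0 <= r -> r <= 1 -> r = k%:~R -> r = 0 \/ r = 1.
  move=> r0 r1 rk; move: r0 r1; rewrite rk ler0z lerz1.
  by case: k {rk} => [[|[|k]]|k] //= _ _; [left|right].
move: pqj; rewrite xt !mxE.
case: (p01 j) (q01 j) => -> [] ->; rewrite ?eqxx // !(mulr0, mulr1) ?add0r ?addr0 => _ E'.
  by have [] := int01 _ (1 - t) _ _ E'; lra.
exact: int01 E'.
Qed.

Lemma zero_one_integral v : (forall j, v 0 j = 0 \/ v 0 j = 1) ->
  exists z : 'rV[int]_d, v = map_mx (fun k : int => k%:~R) z.
Proof.
move=> v01; exists (\row_j (v 0 j == 1)%:Z).
apply/rowP => j; rewrite !mxE; case: (v01 j) => ->; rewrite ?eqxx //.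
by rewrite eq_sym oner_eq0.
Qed.

End ZeroOne.

(** * Binomials in toric and quadratic ideals *)

Lemma mpolyX_inj (K : nzRingType) n (u v : 'X_{1..n}) : 'X_[K, u] = 'X_[v] -> u = v.
Proof.
move/(congr1 (mcoeff v)); rewrite !mcoeffX eqxx; case: eqP => // _ /esym/eqP.
by rewrite oner_eq0.
Qed.

Section Toric.
Variables (K : fieldType) (d n : nat) (a : 'I_n -> 'rV[int]_d).
Hypothesis a_ge0 : forall i j, 0 <= a i 0 j.

(** The exponent vector of [t^(a i) s], with [s] as the last variable. *)
Definition toric_exponent (i : 'I_n) : 'X_{1..d + 1} :=
  [multinom (if split k is inl j then `|a i ord0 j|%N else 1%N) | k < d + 1].

(** Since the coordinates are nonnegative, a monomial is sent to a monomial of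
    the polynomial ring, not just of its field of fractions. *)
Lemma toric_map_monomial (m : 'X_{1..n}) :
  toric_map a 'X_[K, m] = tofrac 'X_[(\sum_i toric_exponent i *+ m i)%MM].
Proof.
rewrite /toric_map mmapX /mmap1 -mprodXnE rmorph_prod; apply: eq_bigr => i _.
rewrite rmorphXn; congr (_ ^+ _).
rewrite [in RHS]mpolyXE_id big_split_ord big_ord1 rmorphM rmorph_prod /=; congr (_ * _).
  apply: eq_bigr => j _; rewrite rmorphXn mnmE split_lshift.
  by rewrite -[X in _ ^ X](gez0_abs (a_ge0 i j)) -exprnP.
by rewrite mnmE split_rshift expr1.
Qed.

Lemma toric_exponent_sum (u v : 'X_{1..n}) :
  (\sum_i toric_exponent i *+ u i = \sum_i toric_exponent i *+ v i)%MM <->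
  mdeg u = mdeg v /\ \sum_i a i *+ u i = \sum_i a i *+ v i.
Proof.
have lE (w : 'X_{1..n}) j : (\sum_i a i *+ w i) 0 j =
    ((\sum_i toric_exponent i *+ w i)%MM (lshift 1 j))%:Z.
  rewrite summxE mnm_sumE -[RHS]natz natr_sum.
  apply: eq_bigr => i _; rewrite mulmnE mnmE split_lshift mulmxnE.
  by rewrite natrM natz gez0_abs // mulr_natr.
have rE (w : 'X_{1..n}) : mdeg w = (\sum_i toric_exponent i *+ w i)%MM (rshift d ord0).
  by rewrite mnm_sumE mdegE; apply: eq_bigr => i _; rewrite mulmnE mnmE split_rshift mul1n.
split=> [E|[E1 E2]]; first by rewrite !rE E; split=> //; apply/rowP => j; rewrite !lE E.
apply/mnmP => k; rewrite -[k]splitK; case: (split k) => [j|j] /=.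
  by move/rowP/(_ j): E2; rewrite !lE => -[].
by rewrite ord1 -!rE.
Qed.

Lemma toric_ideal_binomial (u v : 'X_{1..n}) :
  toric_ideal K a ('X_[u] - 'X_[v]) <->
  mdeg u = mdeg v /\ \sum_i a i *+ u i = \sum_i a i *+ v i.
Proof.
rewrite -toric_exponent_sum /toric_ideal /= /toric_map raddfB /= -!/(toric_map _ _).
rewrite !toric_map_monomial -rmorphB; split=> [/eqP|->]; last by rewrite subrr rmorph0.
by rewrite tofrac_eq0 subr_eq0 => /eqP/mpolyX_inj.
Qed.

End Toric.

Lemma mcoeffMX_notdiv (K : nzRingType) n (q : {mpoly K[n]}) (m v : 'X_{1..n}) :
  ~~ (m <= v)%MM -> (q * 'X_[m])@_v = 0.
Proof.
move=> mv; apply: memN_msupp_eq0; apply: contra mv.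
by rewrite (perm_mem (msuppMX q m)) => /mapP[m' _ ->]; rewrite lem_addr.
Qed.

(** No multiple of a generator contains the monomial [v]: the
    generators, seen as moves between monomials, do not apply to [v]. *)
Lemma ideal_span_isolated (K : fieldType) n (G : set {mpoly K[n]}) (v : 'X_{1..n}) p :
  (forall g, G g -> quadratic_binomial g) ->
  (forall m1 m2, G ('X_[m1] - 'X_[m2]) -> ~~ (m1 <= v)%MM /\ ~~ (m2 <= v)%MM) ->
  ideal_span G p -> p@_v = 0.
Proof.
move=> Gquad Gv [m [q [g [Gg ->]]]]; rewrite raddf_sum big1 // => i _ /=.
have [[m1 [m2 [_ E]]] _] := Gquad _ (Gg i).
have [m1v m2v] : ~~ (m1 <= v)%MM /\ ~~ (m2 <= v)%MM by apply: Gv; rewrite -E.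
by rewrite E mulrBr mcoeffB !mcoeffMX_notdiv ?subrr.
Qed.

Lemma mdeg2P n (m : 'X_{1..n}) : mdeg m = 2 -> exists i j, m = (U_(i) + U_(j))%MM.
Proof.
move=> m2; have [i mi] : exists i, m i != 0%N.
  apply/existsP; apply: contra_eqT m2 => /existsPn m0.
  by rewrite mdegE big1 // => i _; apply/eqP/negbNE/m0.
have im : (U_(i) <= m)%MM by rewrite lep1mP.
have /eqP/mdeg1P[j /eqP mj] : mdeg (m - U_(i)) = 1%N.
  by have := congr1 mdeg (submK im); rewrite mdegD mdeg1 m2 addn1 => -[].
by exists j, i; rewrite -mj submK.
Qed.

Lemma quadratic_binomial_mdeg (K : fieldType) n (m1 m2 : 'X_{1..n}) :
  quadratic_binomial ('X_[K, m1] - 'X_[m2]) ->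
  [/\ m1 != m2, mdeg m1 = 2 & mdeg m2 = 2].
Proof.
move=> [[u [v [uv E]]] /dhomogP h].
have m12 : m1 != m2.
  apply: contra_neqN uv => /eqP m12; move: E; rewrite m12 subrr => /esym/eqP.
  by rewrite subr_eq0 => /eqP/mpolyX_inj ->.
split=> //; apply: h; rewrite mcoeff_msupp mcoeffB !mcoeffX eqxx.
  by rewrite [m2 == _]eq_sym (negPf m12) subr0 oner_eq0.
by rewrite (negPf m12) sub0r oppr_eq0 oner_eq0.
Qed.

(** If every quadratic relation starting from two points of [Q] is trivial, no
    quadratic move applies to a monomial supported in [Q], so that this monomial
    is alone in its fibre. *)
Lemma quadratic_fiber_rigid (K : fieldType) d n (a : 'I_n -> 'rV[int]_d) (Q : pred 'I_n) :
  (forall i j, 0 <= a i 0 j) -> quadratic_ideal (toric_ideal K a) ->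
  (forall i j k l, Q i -> Q j -> a i + a j = a k + a l ->
     (U_(i) + U_(j) = U_(k) + U_(l) :> 'X_{1..n})%MM) ->
  forall u v : 'X_{1..n}, (forall i, v i != 0%N -> Q i) -> mdeg u = mdeg v ->
    \sum_i a i *+ u i = \sum_i a i *+ v i -> u = v.
Proof.
move=> a0 [G [Gquad IG]] rigid u v vQ duv suv.
have pairE i j : \sum_k a k *+ (U_(i) + U_(j))%MM k = a i + a j.
  rewrite (eq_bigr (fun k => a k *+ (i == k) + a k *+ (j == k))) => [|k _].
    rewrite big_split /= (bigD1 i) //= eqxx big1; last first.
      by move=> k /negPf ki; rewrite eq_sym ki.
    by rewrite (bigD1 j) //= eqxx big1 ?addr0 // => k /negPf kj; rewrite eq_sym kj.
  by rewrite mnmDE !mnm1E mulrnDr.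
have divides m1 m2 : mdeg m1 = 2 -> mdeg m2 = 2 ->
    \sum_i a i *+ m1 i = \sum_i a i *+ m2 i -> (m1 <= v)%MM -> m1 = m2.
  move=> /mdeg2P[i [j ->]] /mdeg2P[k [l ->]]; rewrite !pairE => E /mnm_lepP le_v.
  apply: rigid E; apply: vQ; rewrite -lt0n.
    by apply: leq_trans (le_v i); rewrite mnmDE mnm1E eqxx.
  by apply: leq_trans (le_v j); rewrite mnmDE !mnm1E eqxx addn1.
apply/eqP/contraT => /negPf uv.
have : ideal_span G ('X_[u] - 'X_[v]).
  by rewrite -IG; apply/(toric_ideal_binomial K a0).
move/(ideal_span_isolated (v := v) Gquad) => /(_ _)/eqP; rewrite mcoeffB !mcoeffX eqxx uv.
rewrite sub0r oppr_eq0 oner_eq0; apply=> m1 m2 Gm.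
have [m12 d1 d2] := quadratic_binomial_mdeg (Gquad _ Gm).
have /(toric_ideal_binomial K a0)[_ s12] : toric_ideal K a ('X_[m1] - 'X_[m2]).
  rewrite IG; exists 1, (fun=> 1), (fun=> 'X_[m1] - 'X_[m2]).
  by rewrite big_ord1 mul1r; split.
split; apply: contra m12 => mv; apply/eqP; first exact: divides mv.
by apply/esym; apply: divides mv.
Qed.

(** * Separating a set of lattice points from the other ones *)

Lemma clear_denominators (I : finType) (f : I -> rat) : (forall i, 0 <= f i) ->
  exists (N : nat) (g : I -> nat), (0 < N)%N /\ forall i, N%:R * f i = (g i)%:R.
Proof.
move=> f0; pose D i := `|denq (f i)|%N.
exists (\prod_i D i)%N, (fun i => `|numq (f i)| * \prod_(k | k != i) D k)%N.
have denE q : (`|denq q|%N)%:R = (denq q)%:~R :> rat.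
  by rewrite natr_absz gtr0_norm ?denq_gt0.
split=> [|i]; first by rewrite prodn_gt0 // => i; rewrite absz_gt0 denq_eq0.
rewrite (bigD1 i) //= !natrM mulrAC; congr (_ * _).
rewrite denE -{2}[f i]divq_num_den mulrC divfK ?intr_eq0 ?denq_eq0 //.
by rewrite natr_absz ger0_norm // numq_ge0.
Qed.

Section Separation.
Variables (d n : nat) (a : 'I_n -> 'rV[int]_d) (Q : pred 'I_n).

Definition rat_point i : 'rV[rat]_(d + 1) := cone_point (map_mx intr (a i)).

Lemma rat_point_sum (u : 'I_n -> nat) :
  \sum_i (u i)%:R *: rat_point i =
  row_mx (map_mx intr (\sum_i a i *+ u i)) (const_mx (\sum_i u i)%:R).
Proof.
apply/rowP => k; rewrite -[k]splitK summxE; case: (split k) => j /=.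
  rewrite row_mxEl mxE summxE rmorph_sum; apply: eq_bigr => i _.
  by rewrite mxE row_mxEl mxE mulmxnE rmorphMn mulr_natl.
rewrite row_mxEr mxE natr_sum; apply: eq_bigr => i _.
by rewrite mxE row_mxEr mxE mulr1.
Qed.

(** Farkas' lemma for the cone generated by the [- a i] and by the [a i] with
    [i] in [Q]: its dual consists of the functionals that are nonpositive at all
    the points and vanish on [Q]. Membership of [w] in the cone is a relation
    with nonnegative rational coefficients. *)
Lemma separation_or_relation w :
  (exists y, [/\ forall i, sprod y (rat_point i) <= 0,
                 forall i, Q i -> sprod y (rat_point i) = 0
               & sprod y (rat_point w) < 0]) \/
  (exists u v : 'X_{1..n}, [/\ u w != 0%N, forall i, v i != 0%N -> Q i,
      mdeg u = mdeg v & \sum_i a i *+ u i = \sum_i a i *+ v i]).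
Proof.
pose h (k : 'I_(n + n)) := match split k with
  | inl i => - rat_point i | inr i => if Q i then rat_point i else 0 end.
case: (farkas h (rat_point w)) => [[l [l0 E]]|[y [yh yw]]]; last first.
  have y0 i : sprod y (rat_point i) <= 0.
    by rewrite -oppr_ge0 -sprodNr; have := yh (lshift n i); rewrite /h split_lshift.
  left; exists y; split=> // i Qi; apply: le_anti; rewrite y0 /=.
  by have := yh (rshift n i); rewrite /h split_rshift Qi.
have [N [g [N0 gE]]] := clear_denominators l0.
pose u := [multinom (if i == w then N + g (lshift n i) else g (lshift n i))%N | i < n].
pose v := [multinom (if Q i then g (rshift n i) else 0%N) | i < n].
right; exists u, v.
have E' : \sum_i (u i)%:R *: rat_point i = \sum_i (v i)%:R *: rat_point i.
  move/(congr1 ( *:%R N%:R)): E; rewrite big_split_ord scalerDr !scaler_sumr /= => E.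
  transitivity (N%:R *: rat_point w + \sum_i (g (lshift n i))%:R *: rat_point i).
    rewrite (bigD1 w) //= [in RHS](bigD1 w) //= addrA mnmE eqxx natrD scalerDl.
    by congr (_ + _); apply: eq_bigr => i /negPf iw; rewrite mnmE iw.
  rewrite E addrAC -big_split big1 ?add0r /= => [|i _]; last first.
    by rewrite /h split_lshift scalerA gE scalerN addNr.
  apply: eq_bigr => i _; rewrite /h split_rshift scalerA gE mnmE.
  by case: (Q i); rewrite ?scaler0 ?scale0r.
move: E'; rewrite !rat_point_sum => /eq_row_mx[E1 E2].
split.
- by rewrite mnmE eqxx addn_eq0 negb_and -lt0n N0.
- by move=> i; rewrite mnmE; case: (Q i).
- by move/rowP/(_ ord0): E2; rewrite !mxE => /eqP; rewrite eqr_nat !mdegE => /eqP.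
- apply/rowP => j; move/rowP/(_ j): E1; rewrite !mxE; exact: intr_inj.
Qed.

End Separation.

(** One functional for each point outside [Q]; their sum is negative at all of
    them. *)
Lemma strict_separation d n (a : 'I_n -> 'rV[int]_d) (Q : pred 'I_n) :
  (forall u v : 'X_{1..n}, (forall i, v i != 0%N -> Q i) -> mdeg u = mdeg v ->
    \sum_i a i *+ u i = \sum_i a i *+ v i -> u = v) ->
  exists y, forall i, sprod y (rat_point a i) <= 0 ?= iff Q i.
Proof.
move=> rigid.
have /fin_all_exists[y yP] w : exists y, [/\ forall i, sprod y (rat_point a i) <= 0,
    forall i, Q i -> sprod y (rat_point a i) = 0
    & ~~ Q w -> sprod y (rat_point a w) < 0].
  have [[y [y1 y2 y3]]|[u [v [uw vQ duv suv]]]] := separation_or_relation a Q w.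
    by exists y.
  exists 0; have y0 i : sprod 0 (rat_point a i) = 0 by rewrite -(scale0r 0) sprodZl mul0r.
  by split=> [i|//|]; rewrite ?y0 // vQ // -(rigid u v).
exists (\sum_w y w) => i; rewrite sprod_suml; split.
  by apply: sumr_le0 => w _; case: (yP w) => + _ _; apply.
have [Qi|Qi] := boolP (Q i).
  by rewrite big1 // => w _; case: (yP w) => _ y0 _; apply: y0.
apply/negbTE; rewrite lt_eqF // (bigD1 i) //= ltr_wnDr //; last by case: (yP i) => _ _ ->.
by apply: sumr_le0 => w _; case: (yP w) => + _ _; apply.
Qed.

(** * The face spanned by a clique *)

Section Faces.
Variables (R : realType) (d : nat).

Definition real_point (z : 'rV[int]_d) : 'rV[R]_d := map_mx (fun k : int => k%:~R) z.

Lemma real_point_inj : injective real_point.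
Proof. by move=> z z' /rowP E; apply/rowP => j; have := E j; rewrite !mxE => /intr_inj. Qed.

Lemma real_pointD z z' : real_point (z + z') = real_point z + real_point z'.
Proof. by apply/rowP => j; rewrite !mxE rmorphD. Qed.

Lemma rat_separator_real n (a : 'I_n -> 'rV[int]_d) (Q : pred 'I_n) y :
  (forall i, sprod y (rat_point a i) <= 0 ?= iff Q i) ->
  exists c b, forall i, dot c (real_point (a i)) <= b ?= iff Q i.
Proof.
move=> yQ; exists (map_mx ratr (lsubmx y)), (- ratr (y 0 (rshift d ord0))) => i.
have E : dot (map_mx ratr (lsubmx y)) (real_point (a i)) =
    ratr (sprod y (rat_point a i)) - ratr (y 0 (rshift d ord0)).
  rewrite sprod_cone_point rmorphD addrK rmorph_sum; apply: eq_bigr => j _.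
  by rewrite rmorphM !mxE rmorph_int.
rewrite E -[X in _ <= X ?= iff _]add0r; split.
  by rewrite lerD2r lerq0; case: (yQ i).
by rewrite (inj_eq (addIr _)) fmorph_eq0; case: (yQ i).
Qed.

Lemma face_sub (P F : set 'rV[R]_d) : face P F -> F `<=` P.
Proof. by move=> [c [b [_ ->]]] x []. Qed.

Lemma vertices_sub (P : set 'rV[R]_d) : vertices P `<=` P.
Proof. by move=> v /face_sub; apply. Qed.

Lemma vertices_restrict (P F : set 'rV[R]_d) v :
  F `<=` P -> F v -> vertices P v -> vertices F v.
Proof.
move=> FP Fv [c [b [Pb E]]]; exists c, b; split=> [x /FP/Pb//|].
apply/seteqP; split=> [_ ->|x [Fx xb]].
  by split=> //; have [] : (P `&` [set x | dot c x = b]) v by rewrite -E.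
by rewrite E; split=> //; apply: FP.
Qed.

Lemma conv_diag (p : 'rV[R]_d) : conv [set p; p] = [set p].
Proof. by rewrite setUid; apply/seteqP; split=> [x /conv1|]; last exact: conv_sub. Qed.

End Faces.

Theorem corollary1p2 (K : fieldType) (R : realType) (d : nat)
    (P : set 'rV[R]_d) (hP : zero_one_polytope P)
    (n : nat) (a : 'I_n -> 'rV[int]_d) (ha : lattice_points P a)
    (hquad : quadratic_ideal (toric_ideal K a)) :
  forall C : set 'rV[R]_d, sk_clique P C ->
    exists F : set 'rV[R]_d, face P F /\ C = vertices F.
Proof.
move=> C [CV Cadj]; have [polyP P01] := hP; have [a_inj aP] := ha.
have [s [Ps sV]] := polytope_vertex_hull polyP.
pose pt i := real_point R (a i).
have Ppt i : P (pt i) by apply/aP; exists i.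
have vertex_index v : vertices P v -> exists i, v = pt i.
  move=> Pv; have [z vz] := zero_one_integral (P01 v Pv).
  have /aP[i az] : P (map_mx (fun k : int => k%:~R) z) by rewrite -vz; apply: vertices_sub.
  by exists i; rewrite /pt az.
have a0 i j : 0 <= a i 0 j.
  have := Ppt i; rewrite Ps => -[m [l [x [l0 _ xs /rowP/(_ j)]]]].
  rewrite mxE summxE -(ler0z R) => ->; apply: sumr_ge0 => k _.
  by rewrite mxE mulr_ge0 //; case: (P01 _ (sV _ (xs k)) j) => ->.
pose Q i := `[< C (pt i) >].
have rigid i j k l : Q i -> Q j -> a i + a j = a k + a l ->
    (U_(i) + U_(j) = U_(k) + U_(l) :> 'X_{1..n})%MM.
  move=> /asboolP Ci /asboolP Cj E.
  have Pij : face P (conv [set pt i; pt j]).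
    have [->|/eqP ij] := eqVneq (pt i) (pt j); first by rewrite conv_diag; apply: CV.
    by case: (Cadj _ _ Ci Cj ij).
  have E' : pt k + pt l = pt i + pt j by rewrite /pt -!real_pointD E.
  have [] := edge_sum (P01 _ (CV _ Ci)) (P01 _ (CV _ Cj)) Pij (Ppt k) (Ppt l) E' erefl.
    by move=> /real_point_inj/a_inj ki; move: E; rewrite ki => /addrI/a_inj ->.
  move=> /real_point_inj/a_inj kj; move: E; rewrite kj addrC => /addrI/a_inj ->.
  by rewrite addmC.
have [y yQ] := strict_separation (quadratic_fiber_rigid a0 hquad rigid).
have [c [b cb]] := rat_separator_real R yQ.
have s_le x : x \in s -> dot c x <= b.
  by move=> /sV/vertex_index[i ->]; case: (cb i).
have s_eq x : x \in s -> dot c x = b -> C x.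
  by move=> /sV/vertex_index[i ->] /eqP; rewrite (cb i).2 => /asboolP.
have CF : C `<=` P `&` [set x | dot c x = b].
  move=> x Cx; split; first exact: vertices_sub (CV _ Cx).
  have [i E] := vertex_index _ (CV _ Cx); move: Cx; rewrite E => Cx.
  by apply/eqP; rewrite (cb i).2; apply/asboolP.
have FP : P `&` [set x | dot c x = b] `<=` P by move=> x [].
exists (P `&` [set x | dot c x = b]); split.
  by exists c, b; split=> // x; rewrite Ps; apply: conv_le.
apply/seteqP; split=> [x Cx|x Fx].
  exact: vertices_restrict FP (CF _ Cx) (CV _ Cx).
apply: (vertex_in_generators Fx CF).
have [] := vertices_sub Fx; rewrite Ps => Px xb.
by apply: conv_mono (conv_face s_le Px xb) => z [/s_eq zC /zC].
Qed.
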